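(* (a) If $G_1$ and $G_2$ are $L$-cospectral regular graphs, and $H$ is an arbitrary graph, then $G_1\underline{\vee} H$ and $G_2\underline{\vee} H$ are $L$-cospectral. (b) If $G$ is a regular graph, and $H_1$ and $H_2$ are $L$-cospectral graphs, then $G\underline{\vee} H_1$ and $G\underline{\vee} H_2$ are $L$-cospectral. (c) If $G_1$ and $G_2$ are $L$-cospectral regular graphs, and $H_1$ and $H_2$ are $L$-cospectral graphs, then $G_1\underline{\vee} H_1$ and $G_2\underline{\vee} H_2$ are $L$-cospectral.
   Context: All graphs are finite, simple and undirected, with at least one vertex. $L(G)=D(G)-A(G)$ is the Laplacian matrix of $G$ ($D(G)$ the diagonal degree matrix, $A(G)$ the adjacency matrix); two graphs are $L$-cospectral if their Laplacian matrices have the same spectrum (eigenvalues counted with multiplicity). The subdivision graph $\mathcal{S}(G)$ is obtained from $G$ by inserting a new vertex into every edge of $G$; $I(G)$ denotes the set of inserted vertices. For vertex-disjoint graphs $G,H$, the subdivision-edge join $G\underline{\vee}H$ is the graph obtained from $\mathcal{S}(G)$ and $H$ by joining every vertex of $I(G)$ with every vertex of $V(H)$. *)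

(* Defs.v *)
From mathcomp Require Import all_boot all_order all_algebra all_field.

Set Implicit Arguments.
Unset Strict Implicit.
Unset Printing Implicit Defensive.

Import GRing.Theory.
Local Open Scope ring_scope.

Record graph := Graph {
  vertex :> finType;
  adj : rel vertex;
  adj_sym : symmetric adj;
  adj_irr : irreflexive adj;
  vertex_nonempty : (0 < #|vertex|)%N }.

Definition degree (G : graph) (x : G) : nat := #|[set y | adj x y]|.

Definition regular (G : graph) : Prop :=
  exists r : nat, forall x : G, degree x = r.

(* Matrices are indexed by the ranks of the vertices in [enum G]; another
   ordering conjugates them by a permutation matrix. *)
Definition adjacency_mx (G : graph) : 'M[algC]_#|G| :=
  \matrix_(i, j) (adj (enum_val i) (enum_val j))%:R.

Definition degree_mx (G : graph) : 'M[algC]_#|G| :=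
  diag_mx (\row_i (degree (enum_val i))%:R).

Definition laplacian_mx (G : graph) : 'M[algC]_#|G| :=
  degree_mx G - adjacency_mx G.

(* The roots of the characteristic polynomial, each repeated according to its
   multiplicity. The order is unspecified, so spectra are compared by
   [perm_eq]. The eigenvalues of an integer matrix are algebraic numbers, so
   none is lost by working over [algC]. *)
Definition spectrum n (A : 'M[algC]_n) : seq algC :=
  sval (closed_field_poly_normal (char_poly A)).

Definition L_cospectral (G H : graph) : Prop :=
  perm_eq (spectrum (laplacian_mx G)) (spectrum (laplacian_mx H)).

Definition edge_set (G : graph) : {set {set G}} :=
  [set [set p.1; p.2] | p : G * G & adj p.1 p.2].

Definition edge (G : graph) : finType := {e : {set G} | e \in edge_set G}.

(* [inl x] is an original vertex, [inr e] the vertex inserted into [e]. *)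
Definition subdivision_adj (G : graph) : rel (G + edge G)%type := fun u v =>
  match u, v with
  | inl x, inr e | inr e, inl x => x \in val e
  | _, _ => false
  end.

Lemma subdivision_adj_sym (G : graph) : symmetric (@subdivision_adj G).
Proof. by case=> ? []. Qed.

Lemma subdivision_adj_irr (G : graph) : irreflexive (@subdivision_adj G).
Proof. by case. Qed.

Lemma subdivision_nonempty (G : graph) : (0 < #|{: G + edge G}|)%N.
Proof. by rewrite card_sum ltn_addr ?vertex_nonempty. Qed.

Definition subdivision (G : graph) : graph :=
  Graph (@subdivision_adj_sym G) (@subdivision_adj_irr G)
        (subdivision_nonempty G).

Definition inserted (G : graph) (u : subdivision G) : bool :=
  if u is inr _ then true else false.

Definition subdivision_edge_join_adj (G H : graph) :
    rel (subdivision G + H)%type := fun u v =>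
  match u, v with
  | inl s, inl t => adj s t
  | inr x, inr y => adj x y
  | inl s, inr _ | inr _, inl s => inserted s
  end.

Lemma subdivision_edge_join_adj_sym (G H : graph) :
  symmetric (@subdivision_edge_join_adj G H).
Proof. by case=> x [] y; rewrite /subdivision_edge_join_adj // adj_sym. Qed.

Lemma subdivision_edge_join_adj_irr (G H : graph) :
  irreflexive (@subdivision_edge_join_adj G H).
Proof. by case=> x; rewrite /subdivision_edge_join_adj adj_irr. Qed.

Lemma subdivision_edge_join_nonempty (G H : graph) :
  (0 < #|{: subdivision G + H}|)%N.
Proof. by rewrite card_sum ltn_addr ?vertex_nonempty. Qed.

Definition subdivision_edge_join (G H : graph) : graph :=
  Graph (@subdivision_edge_join_adj_sym G H)
        (@subdivision_edge_join_adj_irr G H)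
        (subdivision_edge_join_nonempty G H).

(* Main.v *)
(** Let [G] be [r]-regular with [n] vertices, [m] edges and incidence matrix
    [B], and let [H] have [p] vertices. Up to reordering, [x - L] of the join is
    [[a, B, 0], [B^T, b, J], [0, J^T, c - L(H)]] with [a = x - r],
    [b = x - 2 - p], [c = x - m]. All-ones vectors satisfy [B 1 = r 1],
    [B^T 1 = 2 1] and [L(H) 1 = 0], so the all-ones blocks [J] can be factored
    out on the right into a matrix depending only on [n, m, p, r, x]. What is
    left is [\det (c - L(H))] times the determinant of [[a, B], [B^T, b]], which
    reduces to [\det (a b - B B^T)] with [B B^T = 2 r - L(G)]. Hence, for all but
    finitely many [x], the characteristic polynomial of the join at [x] is a
    function of those of [L(G)] and [L(H)] and of [n, m, p, r]. The sizes are
    read off the degrees, [r] off the trace [n r] of [L(G)], and [2 m = n r]. *)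

Require Import Defs.
From mathcomp Require Import all_boot all_order all_fingroup all_algebra.
From mathcomp Require Import all_field.
From mathcomp Require Import ring.

Set Implicit Arguments.
Unset Strict Implicit.
Unset Printing Implicit Defensive.

Import GRing.Theory Num.Theory.
Local Open Scope ring_scope.

(** * Characteristic polynomials, their values and their roots *)

Lemma horner_char_poly (R : comNzRingType) n (A : 'M[R]_n) (x : R) :
  (char_poly A).[x] = \det (x%:M - A).
Proof.
rewrite -horner_evalE -det_map_mx /= map_mxB /= map_scalar_mx /=.
rewrite horner_evalE hornerX -map_mx_comp map_mx_id // => a /=.
by rewrite horner_evalE hornerC.
Qed.

(** The product [g * (p - q)] vanishes everywhere. If it were nonzero, the naturals below its size,
    distinct in characteristic zero, would be too many roots. *)
Lemma poly_eq_generic (R : numDomainType) (g p q : {poly R}) :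
  g != 0 -> (forall x, g.[x] != 0 -> p.[x] = q.[x]) -> p = q.
Proof.
move=> g0 gpq; apply/eqP; rewrite -subr_eq0.
have /eqP : g * (p - q) = 0.
  apply/eqP/negP => /negP nz.
  pose rs : seq R := [seq k%:R | k <- iota 0 (size (g * (p - q))%R)].
  suff : (size rs < size (g * (p - q))%R)%N by rewrite size_map size_iota ltnn.
  apply: max_poly_roots => //; last first.
    by rewrite map_inj_uniq ?iota_uniq // => i j /eqP; rewrite eqr_nat => /eqP.
  apply/allP => x _; rewrite rootE hornerM hornerD hornerN mulf_eq0 subr_eq0.
  by case: eqVneq => //= gx; rewrite gpq.
by rewrite mulf_eq0 (negPf g0).
Qed.

(** Two enumerations of [T] differ by a permutation [s], which acts on rows and columns alike, so
    its sign enters twice and cancels. *)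
Lemma det_reindex (R : comNzRingType) (T : finType) k l (g : 'I_k -> T)
    (h : 'I_l -> T) (F : T -> T -> R) : bijective g -> bijective h ->
  \det (\matrix_(i, j) F (g i) (g j)) = \det (\matrix_(i, j) F (h i) (h j)).
Proof.
move=> gbij hbij.
have kl : k = l.
  by rewrite -(card_ord k) -(card_ord l) (bij_eq_card gbij) (bij_eq_card hbij).
case: l / kl h hbij => h /bij_inj h_inj; have [g' gK g'K] := gbij.
pose s := perm (inj_comp (can_inj g'K) h_inj).
have -> : \matrix_(i, j) F (h i) (h j) =
          row_perm s (col_perm s (\matrix_(i, j) F (g i) (g j))).
  by apply/matrixP => i j; rewrite !mxE !permE /= !g'K.
rewrite row_permE col_permE !det_mulmx !det_perm odd_permV.
by rewrite mulrC -mulrA -signr_addb addbb mulr1.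
Qed.

Lemma spectrum_char_poly n (A : 'M[algC]_n) :
  \prod_(z <- spectrum A) ('X - z%:P) = char_poly A.
Proof.
rewrite /spectrum; case: closed_field_poly_normal => s /= def_p.
by rewrite [RHS]def_p (monicP (char_poly_monic A)) scale1r.
Qed.

(** A monic polynomial and the multiset of its roots determine each other. *)
Lemma cospectralP G H :
  L_cospectral G H <->
  char_poly (laplacian_mx G) = char_poly (laplacian_mx H).
Proof.
rewrite /L_cospectral -!spectrum_char_poly.
by split=> [LL | /prod_XsubC_eq //]; apply: perm_big.
Qed.

(** * Counting incidences between vertices and edges *)

Section Graph.
Variable G : graph.

Lemma degreeE (x : G) : degree x = (\sum_y adj x y)%N.
Proof.
rewrite /degree -sum1dep_card big_mkcond; apply: eq_bigr => y _.
by case: adj.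
Qed.

Lemma edgeP (e : {set G}) x :
  reflect (exists2 y, adj x y & e = [set x; y])
          ((e \in edge_set G) && (x \in e)).
Proof.
apply: (iffP andP) => [[/imsetP[[u v]] /[1!inE] /= uv ->] | [y xy ->]];
  last first.
  by rewrite set21; split; first by apply/imsetP; exists (x, y); rewrite ?inE.
rewrite in_set2 => /orP[] /eqP->; first by exists v.
by exists u; rewrite 1?setUC // adj_sym.
Qed.

Lemma neq_adj (x y : G) : adj x y -> x != y.
Proof. by move=> xy; apply: contraTneq xy => ->; rewrite adj_irr. Qed.

Lemma card_edge (e : {set G}) : e \in edge_set G -> #|e| = 2.
Proof. by case/imsetP=> p /[1!inE] /neq_adj ne ->; rewrite cards2 ne. Qed.

(** The map sending [y] to [[set x; y]] is a bijection from the neighbours of [x] to the edges at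
    [x]. *)
Lemma sum_incident (x : G) : (\sum_(e : edge G) (x \in val e) = degree x)%N.
Proof.
have set2_inj : {in [set y | adj x y] &, injective (fun y => [set x; y])}.
  move=> y z; rewrite !inE => xy _ yz.
  have : y \in [set x; z] by rewrite -yz set22.
  by rewrite in_set2 eq_sym (negPf (neq_adj xy)) => /eqP.
rewrite -(big_sub (mem (edge_set G)) (fun e => nat_of_bool (x \in e))).
rewrite /degree -(card_in_imset set2_inj) -sum1_card big_mkcond [RHS]big_mkcond.
apply: eq_bigr => e _ /=.
have -> : (e \in [set [set x; y] | y in [set y | adj x y]]) =
          (e \in edge_set G) && (x \in e).
  apply/imsetP/edgeP => -[y]; first by rewrite inE; exists y.
  by exists y; rewrite ?inE.
by case: (e \in _); case: (x \in e).
Qed.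

(** The only edge that can contain two distinct vertices is the pair itself. This gives the
    off-diagonal entries of [B *m B^T]. *)
Lemma sum_incident2 (x y : G) : x != y ->
  (\sum_(e : edge G) (x \in val e) * (y \in val e) = adj x y)%N.
Proof.
move=> xy.
rewrite -(big_sub (mem (edge_set G)) (fun e => (x \in e) * (y \in e)))%N.
have exy e : (e \in edge_set G) && (x \in e) && (y \in e) =
             (e == [set x; y]) && adj x y.
  apply/idP/andP => [/andP[/edgeP[z xz ->]] | [/eqP-> axy]].
    by rewrite in_set2 eq_sym (negPf xy) => /eqP->.
  by rewrite set22 andbT; apply/edgeP; exists y.
rewrite big_mkcond (bigD1 [set x; y]) //= big1 => [|e /negPf ne].
  by have := exy [set x; y]; rewrite set21 set22 eqxx !andbT /= => ->; case: adj.
by have := exy e; rewrite ne; case: (e \in _); case: (x \in e); case: (y \in e).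
Qed.

Lemma sum_endpoints (e : edge G) : (\sum_x (x \in val e) = 2)%N.
Proof.
rewrite -[RHS](card_edge (valP e)) -sum1_card [RHS]big_mkcond.
by apply: eq_bigr => x _; case: (x \in _).
Qed.

Lemma double_card_edge r :
  (forall x : G, degree x = r) -> (#|edge G| * 2 = #|G| * r)%N.
Proof.
move=> Gr; rewrite -!sum_nat_const.
(* Incident pairs are counted by edges, then by vertices. *)
rewrite -(eq_bigr _ (fun e _ => sum_endpoints e)) exchange_big.
by apply: eq_bigr => x _; rewrite -(Gr x) sum_incident.
Qed.

End Graph.

(** * Degrees in the join *)

Section Join.
Variables G H : graph.
Notation J := (subdivision_edge_join G H).

Lemma degree_join_vertex (x : G) : degree (inl (inl x) : J) = degree x.
Proof.
rewrite degreeE !big_sumType /= big1 // [X in (_ + X)%N]big1 // add0n addn0.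
exact: sum_incident.
Qed.

Lemma degree_join_edge (e : edge G) : degree (inl (inr e) : J) = (2 + #|H|)%N.
Proof.
rewrite degreeE !big_sumType /= sum_endpoints big1 // addn0 sum1_card.
by [].
Qed.

Lemma degree_join_right (x : H) :
  degree (inr x : J) = (#|edge G| + degree x)%N.
Proof.
by rewrite degreeE !big_sumType /= big1 // add0n sum1_card -degreeE.
Qed.

End Join.

(** * Laplacian and incidence matrices *)

Lemma sum_enum_val (V : nmodType) (T : finType) (F : T -> V) :
  \sum_(i < #|T|) F (enum_val i) = \sum_x F x.
Proof. by rewrite [RHS](reindex _ (onW_bij _ (enum_val_bij T))). Qed.

Definition incidence_mx (G : graph) : 'M[algC]_(#|G|, #|edge G|) :=
  \matrix_(i < #|G|, j < #|edge G|)
    (enum_val i \in val (enum_val j : edge G))%:R.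

Section Matrices.
Variable G : graph.
Notation B := (incidence_mx G).
Notation L := (laplacian_mx G).

Lemma laplacian_mxE i j :
  L i j =
  (degree (enum_val i))%:R *+ (i == j) - (adj (enum_val i) (enum_val j))%:R.
Proof. by rewrite !mxE. Qed.

Lemma laplacian_mul_const q (c : algC) : L *m const_mx c = 0 :> 'M_(_, q).
Proof.
apply/matrixP => i k; rewrite !mxE.
under eq_bigr do rewrite laplacian_mxE mxE.
rewrite -mulr_suml sumrB.
rewrite (sum_enum_val (fun y => (adj (enum_val i) y)%:R)) -natr_sum -degreeE.
rewrite (bigD1 i) //= eqxx big1 ?addr0 ?subrr ?mul0r // => j.
by rewrite eq_sym => /negPf->.
Qed.

Variable r : nat.
Hypothesis Gr : forall x : G, degree x = r.

(** Entry [(i, j)] counts the edges through both vertices: [r] on the diagonal, adjacency off it. So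
    the product is [r + A], while [L] is [r - A]. *)
Lemma incidence_mul_tr : B *m B^T = (2 * r%:R)%:M - L.
Proof.
apply/matrixP => i j; rewrite mxE [RHS]mxE [X in _ + X]mxE laplacian_mxE !mxE.
transitivity (\sum_(e : edge G)
  ((enum_val i \in val e) * (enum_val j \in val e))%:R : algC).
  rewrite -[RHS]sum_enum_val; apply: eq_bigr => e _.
  by rewrite !mxE natrM.
rewrite -natr_sum; have [<-|ij] := eqVneq i j.
  under eq_bigr do rewrite mulnb andbb.
  by rewrite sum_incident adj_irr !Gr subr0 mulr_natl mulr2n addrK.
rewrite sum_incident2 ?(inj_eq enum_val_inj) // !mulr0n.
by ring.
Qed.

Lemma incidence_mul_const q (c : algC) :
  B *m const_mx c = const_mx (r%:R * c) :> 'M_(_, q).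
Proof.
apply/matrixP => i k; rewrite !mxE.
under eq_bigr do rewrite !mxE.
rewrite -mulr_suml (sum_enum_val (fun e : edge G => (enum_val i \in val e)%:R)).
by rewrite -natr_sum sum_incident Gr.
Qed.

Lemma tr_incidence_mul_const q (c : algC) :
  B^T *m const_mx c = const_mx (2 * c) :> 'M_(_, q).
Proof.
apply/matrixP => i k; rewrite !mxE.
under eq_bigr do rewrite !mxE.
rewrite -mulr_suml (sum_enum_val (fun x : G => (x \in val (enum_val i))%:R)).
by rewrite -natr_sum sum_endpoints.
Qed.

End Matrices.

(** * Determinants of the block matrices *)

Section BlockDeterminant.
Variables (F : fieldType) (n m p : nat).
Variables (B : 'M[F]_(n, m)) (C : 'M[F]_p) (r a b c : F).
Notation d := (a * b - 2 * r).

(** Right multiplication by [[[b, 0], [- B^T, 1]]], of determinant [b ^+ n], clears the lower left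
    block. Nothing is divided by [b]. *)
Lemma det_scalar_block :
  b ^+ n * \det (block_mx a%:M B B^T b%:M) =
  \det ((a * b)%:M - B *m B^T) * b ^+ m.
Proof.
rewrite -(det_scalar n b) -(det_scalar m b) -(det_ublock _ B).
have -> : \det (b%:M : 'M_n) = \det (block_mx b%:M 0 (- B^T) 1%:M).
  by rewrite det_lblock det1 mulr1.
rewrite mulrC -det_mulmx mulmx_block -scalar_mxM !mulmxN !mulmx0 !mulmx1 !add0r.
by rewrite scalar_mxC subrr.
Qed.

(* [s = - r / d] and [t = a / d] solve [a s + r t = 0] and [2 s + b t = 1]. *)
Definition coupling_mx : 'M[F]_(n + m + p) :=
  block_mx 1%:M (col_mx (const_mx (- r / d)) (const_mx (a / d)))
           (row_mx 0 (const_mx c^-1)) 1%:M.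

(** The matrix is the block diagonal of [[[a, B], [B^T, b]]] and [C], times [coupling_mx] on the
    right. The last factor involves neither [B] nor [C]. *)
Lemma det_join_block :
    d != 0 -> c != 0 ->
    (forall q k, B *m const_mx k = const_mx (r * k) :> 'M_(_, q)) ->
    (forall q k, B^T *m const_mx k = const_mx (2 * k) :> 'M_(_, q)) ->
    (forall q k, C *m const_mx k = const_mx (c * k) :> 'M_(_, q)) ->
  \det (block_mx (block_mx a%:M B B^T b%:M) (col_mx 0 (const_mx 1))
                 (row_mx 0 (const_mx 1)) C) =
  \det (block_mx a%:M B B^T b%:M) * \det C * \det coupling_mx.
Proof.
move=> d0 c0 B1 Bt1 C1.
rewrite -(det_ublock _ 0) -det_mulmx mulmx_block !mul0mx !addr0 !add0r !mulmx1.
congr (\det (block_mx _ _ _ _)).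
  rewrite mul_block_col !mul_scalar_mx !scalemx_const B1 Bt1.
  by congr col_mx; apply/matrixP => i j; rewrite !mxE; field.
by rewrite mul_mx_row mulmx0 C1 divff.
Qed.

End BlockDeterminant.

(** * The characteristic polynomial of the join *)

Section JoinCharPoly.
Variables G H : graph.
Notation J := (subdivision_edge_join G H).

(** This order (vertices of [G], inserted vertices, vertices of [H]) matches the block layout;
    [join_rank] is its inverse. *)
Definition join_vertex (i : 'I_(#|G| + #|edge G| + #|H|)) : J :=
  match split i with
  | inl k => match split k with
             | inl u => inl (inl (enum_val u))
             | inr e => inl (inr (enum_val e))
             end
  | inr v => inr (enum_val v)
  end.

Definition join_rank (u : J) : 'I_(#|G| + #|edge G| + #|H|) :=
  match u with
  | inl (inl x) => lshift _ (lshift _ (enum_rank x))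
  | inl (inr e) => lshift _ (rshift _ (enum_rank e))
  | inr y => rshift _ (enum_rank y)
  end.

Lemma join_vertex_bij : bijective join_vertex.
Proof.
exists join_rank => [i | [[x | e] | y]]; rewrite /join_vertex.
- case: split_ordP => k ->; last by rewrite /= enum_valK.
  by case: split_ordP => u ->; rewrite /= enum_valK.
- by rewrite /= (unsplitK (inl _)) (unsplitK (inl _)) enum_rankK.
- by rewrite /= (unsplitK (inl _)) (unsplitK (inr _)) enum_rankK.
- by rewrite /= (unsplitK (inr _)) enum_rankK.
Qed.

Variable r : nat.
Hypothesis Gr : forall x : G, degree x = r.
Variable x : algC.
Let a := x - r%:R.
Let b := x - (2 + #|H|)%:R.
Let c := x - #|edge G|%:R.

Lemma horner_char_poly_join :
  (char_poly (laplacian_mx J)).[x] =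
  \det (block_mx
    (block_mx a%:M (incidence_mx G) (incidence_mx G)^T b%:M)
    (col_mx 0 (const_mx 1)) (row_mx 0 (const_mx 1)) (c%:M - laplacian_mx H)).
Proof.
(* The entries of [x - L] as a function of vertices, free of any ordering, so that [det_reindex]
   applies. *)
pose F (u v : J) := (x - (degree u)%:R) *+ (u == v) + (adj u v)%:R.
rewrite horner_char_poly.
transitivity (\det (\matrix_(i < #|J|, j < #|J|) F (enum_val i) (enum_val j))).
  congr (\det _); apply/matrixP => i j.
  by rewrite !mxE /F (inj_eq enum_val_inj) mulrnBl opprB addrA addrAC.
rewrite (det_reindex _ (@enum_val_bij J) join_vertex_bij).
congr (\det _); apply/matrixP => i j; rewrite mxE /join_vertex /F.
case: (split_ordP i) => i1 ->; case: (split_ordP j) => j1 ->.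
- rewrite block_mxEul.
  case: (split_ordP i1) => i2 ->; case: (split_ordP j1) => j2 ->.
  + rewrite block_mxEul mxE degree_join_vertex Gr /= addr0.
    by rewrite !(inj_eq inl_inj) (inj_eq enum_val_inj).
  + by rewrite block_mxEur !mxE /= add0r.
  + by rewrite block_mxEdl !mxE /= add0r.
  + rewrite block_mxEdr mxE degree_join_edge /= addr0.
    by rewrite (inj_eq inl_inj) (inj_eq inr_inj) (inj_eq enum_val_inj).
- rewrite block_mxEur.
  by case: (split_ordP i1) => i2 ->; rewrite ?col_mxEu ?col_mxEd !mxE /= add0r.
- rewrite block_mxEdl.
  by case: (split_ordP j1) => j2 ->; rewrite ?row_mxEl ?row_mxEr !mxE /= add0r.
- rewrite block_mxEdr !mxE degree_join_right.
  rewrite (inj_eq inr_inj) (inj_eq enum_val_inj) /c natrD opprD.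
  by rewrite opprB addrA mulrnBl addrAC addrA.
Qed.

Let d := a * b - 2 * r%:R.

Lemma char_poly_join_value : b != 0 -> c != 0 -> d != 0 ->
  (char_poly (laplacian_mx J)).[x] =
  b ^- #|G| * ((-1) ^+ #|G| * (char_poly (laplacian_mx G)).[- d]
                * b ^+ #|edge G|) *
  (char_poly (laplacian_mx H)).[c] *
  \det (coupling_mx #|G| #|edge G| #|H| r%:R a b c).
Proof.
move=> b0 c0 d0; rewrite horner_char_poly_join.
rewrite (@det_join_block _ _ _ _ _ _ r%:R _ _ c) //.
- rewrite -horner_char_poly; congr (_ * _ * _).
  (* Multiplying by [b ^+ #|G|] brings in [det_scalar_block]. Then [a * b - B *m B^T] is [d + L],
     the opposite of [- d - L]: hence the sign and the point [- d]. *)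
  apply: (mulfI (expf_neq0 #|G| b0)).
  rewrite det_scalar_block mulVKf ?expf_neq0 //.
  congr (_ * _); rewrite (incidence_mul_tr Gr) horner_char_poly -detZ scaleN1r.
  congr (\det _).
  rewrite /d (opprB (a * b)) [X in _ = - (X - _)]raddfB /= !opprB.
  by rewrite addrCA.
- exact: incidence_mul_const.
- exact: tr_incidence_mul_const.
move=> q k; rewrite mulmxBl laplacian_mul_const subr0 mul_scalar_mx.
by rewrite scalemx_const.
Qed.

End JoinCharPoly.

(** * Parameters read off the spectrum, and the conclusion *)

Lemma regular_degree_trace (G : graph) r :
  (forall x : G, degree x = r) -> \tr (laplacian_mx G) = (#|G| * r)%:R.
Proof.
move=> Gr; rewrite /mxtrace natrM.
rewrite (eq_bigr (fun=> r%:R)) => [|i _]; last first.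
  by rewrite laplacian_mxE eqxx adj_irr subr0 Gr.
by rewrite sumr_const card_ord mulr_natl.
Qed.

Lemma L_cospectral_card (G H : graph) : L_cospectral G H -> #|G| = #|H|.
Proof.
move/cospectralP/(congr1 (fun p : {poly algC} => size p)).
by rewrite !size_char_poly => -[].
Qed.

(** The trace, up to sign a coefficient of the characteristic polynomial, is the order times the
    degree, and the order is positive. *)
Lemma L_cospectral_degree (G1 G2 : graph) r1 r2 :
    (forall x : G1, degree x = r1) -> (forall x : G2, degree x = r2) ->
  L_cospectral G1 G2 -> r1 = r2.
Proof.
move=> Gr1 Gr2 GG; have n12 := L_cospectral_card GG.
have /eqP : \tr (laplacian_mx G1) = \tr (laplacian_mx G2).
  apply: oppr_inj; rewrite -!char_poly_trace ?vertex_nonempty //.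
  by have /cospectralP-> := GG; rewrite n12.
rewrite (regular_degree_trace Gr1) (regular_degree_trace Gr2) eqr_nat n12.
by rewrite eqn_pmul2l ?vertex_nonempty // => /eqP.
Qed.

Lemma L_cospectral_join (G1 G2 H1 H2 : graph) :
    regular G1 -> regular G2 -> L_cospectral G1 G2 -> L_cospectral H1 H2 ->
  L_cospectral (subdivision_edge_join G1 H1) (subdivision_edge_join G2 H2).
Proof.
move=> [r Gr1] [r2 Gr2] GG HH.
move: (L_cospectral_degree Gr1 Gr2 GG) => r12; case: r2 / r12 Gr2 => Gr2.
have nG := L_cospectral_card GG; have nH := L_cospectral_card HH.
have mG : #|edge G1| = #|edge G2|.
  apply/eqP; rewrite -(eqn_pmul2r (isT : 0 < 2)%N).
  by rewrite (double_card_edge Gr1) (double_card_edge Gr2) nG.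
have /cospectralP GGp := GG; have /cospectralP HHp := HH; apply/cospectralP.
(* These are [b], [c] and [d] as polynomials in [x]; the value formula is available away from their
   roots. *)
pose pb : {poly algC} := 'X - (2 + #|H2|)%:R%:P.
pose pc : {poly algC} := 'X - #|edge G2|%:R%:P.
pose pd : {poly algC} := ('X - r%:R%:P) * pb - (2 * r%:R)%:P.
have pd0 : pd != 0.
  (* The product of two monic linear factors has size 3, a constant at most 1. *)
  rewrite subr_eq0; apply/eqP => /(congr1 (fun p : {poly algC} => size p)).
  rewrite size_Mmonic ?monicXsubC ?polyXsubC_eq0 // !size_XsubC /= => sz.
  by have := size_polyC_leq1 (2 * r%:R : algC); rewrite -sz.
apply: (@poly_eq_generic _ (pb * pc * pd)) => [|x].
  by rewrite !mulf_neq0 ?polyXsubC_eq0.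
rewrite !hornerM !mulf_eq0 !negb_or /pd !(hornerE, hornerXsubC).
move=> /andP[/andP[b0 c0] d0].
rewrite (char_poly_join_value Gr1) ?(char_poly_join_value Gr2) ?nH ?mG //.
by rewrite GGp HHp nG nH.
Qed.

Theorem corollary3p8 :
  (forall G1 G2 H : graph,
     regular G1 -> regular G2 -> L_cospectral G1 G2 ->
     L_cospectral (subdivision_edge_join G1 H) (subdivision_edge_join G2 H)) /\
  (forall G H1 H2 : graph,
     regular G -> L_cospectral H1 H2 ->
     L_cospectral (subdivision_edge_join G H1) (subdivision_edge_join G H2)) /\
  (forall G1 G2 H1 H2 : graph,
     regular G1 -> regular G2 -> L_cospectral G1 G2 -> L_cospectral H1 H2 ->
     L_cospectral (subdivision_edge_join G1 H1) (subdivision_edge_join G2 H2)).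
Proof.
split=> [G1 G2 H rG1 rG2 GG|].
  (* A graph is cospectral to itself, so (a) and (b) are instances of (c). *)
  by apply: L_cospectral_join => //; apply: perm_refl.
split=> [G H1 H2 rG HH|]; last exact: L_cospectral_join.
by apply: L_cospectral_join => //; apply: perm_refl.
Qed.
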